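(* Let $\alpha\in(0,1)$, $a<b$, let $A\in\mathbb{R}^{d\times d}$ be a real symmetric matrix, $B\in\mathbb{R}^{d\times N}$ a real matrix, and let $g\in C([a,b];\mathbb{R})$ satisfy $g(t)\neq0$ for almost every $t\in[a,b]$. Let $y_0\in\mathbb{R}^d$. The system $$ {}_a^C\mathrm{D}_t^{\alpha}y(t)=A g(t)y(t)+Bu(t),\quad t\in[a,b],\qquad y(a)=y_0, $$ is controllable if and only if the controllability Gramian matrix $$ W(a,b)=\int_a^b(b-t)^{1-\alpha}\,\Phi(t,b)BB^{\mathrm T}\Phi(t,b)^{\mathrm T}\,dt $$ is nonsingular.
   Context: Left Riemann-Liouville integral: ${}_a\mathrm{I}_t^{\alpha}\varphi(t)=\frac{1}{\Gamma(\alpha)}\int_a^t(t-s)^{\alpha-1}\varphi(s)\,ds$. Left Caputo derivative: ${}_a^C\mathrm{D}_t^{\alpha}\varphi(t)=\frac{1}{\Gamma(1-\alpha)}\int_a^t\frac{\varphi'(s)}{(t-s)^{\alpha}}\,ds$. State-transition matrices: $\Psi(a,t)=\sum_{k\ge0}A^k\,{}_a\mathrm{J}_t^{k\circ\alpha}g(t)$ with ${}_a\mathrm{J}_t^{0\circ\alpha}g=1$ and ${}_a\mathrm{J}_t^{k\circ\alpha}g={}_a\mathrm{I}_t^{\alpha}\big(g\cdot{}_a\mathrm{J}_t^{(k-1)\circ\alpha}g\big)$ for $k\ge1$; and, for $a\le\tau<t\le b$, $\Phi(\tau,t)=\sum_{k\ge0}A^k\,{}_\tau\mathrm{I}_t^{k\circ\alpha}g(t)$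 with ${}_\tau\mathrm{I}_t^{0\circ\alpha}g(t)=\frac{(t-\tau)^{\alpha-1}}{\Gamma(\alpha)}$ and ${}_\tau\mathrm{I}_t^{k\circ\alpha}g={}_\tau\mathrm{I}_t^{\alpha}\big(g\cdot{}_\tau\mathrm{I}_t^{(k-1)\circ\alpha}g\big)$ for $k\ge1$. Equivalently, for fixed $t$, $\tau\mapsto\Phi(\tau,t)$ is the solution of ${}_\tau\mathrm{D}_t^{\alpha}\Phi(\tau,t)=Ag(\tau)\Phi(\tau,t)$, ${}_\tau\mathrm{I}_t^{1-\alpha}\Phi(\tau,t)|_{\tau=t}=\mathbb{I}$ (identity matrix), where the right Riemann-Liouville operators are ${}_\tau\mathrm{I}_t^{\beta}\varphi(\tau)=\frac1{\Gamma(\beta)}\int_\tau^t(s-\tau)^{\beta-1}\varphi(s)\,ds$ and ${}_\tau\mathrm{D}_t^{\alpha}\varphi(\tau)=-\frac{d}{d\tau}\,{}_\tau\mathrm{I}_t^{1-\alpha}\varphi(\tau)$. The solution of the system is given by $y(t)=\Psi(a,t)y_0+\int_a^t\Phi(\tau,t)Bu(\tau)\,d\tau$. The system is called controllable if for every $y_b\in\mathbb{R}^d$ there exists a control function $u:[a,b]\to\mathbb{R}^N$ such that the solution of the system satisfies $y(b)=y_b$. $(\cdot)^{\mathrm T}$ denotes the transpose. *)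

(* Defs.v *)
(* All integrals are Lebesgue integrals. *)
From HB Require Import structures.
From mathcomp Require Import all_boot all_order all_algebra.
From mathcomp Require Import all_classical all_reals all_analysis.
Set Implicit Arguments.
Unset Strict Implicit.
Unset Printing Implicit Defensive.
Import Order.TTheory GRing.Theory Num.Theory.
Import numFieldNormedType.Exports.
Local Open Scope classical_set_scope.
Local Open Scope ring_scope.

Definition Gamma (R : realType) (x : R) : R :=
  \int[lebesgue_measure]_(s in `]0, +oo[) (s `^ (x - 1) * expR (- s)).

(* Left Riemann-Liouville integral of order [al] with lower limit [a]. *)
Definition RLint (R : realType) (al a : R) (phi : R -> R) (t : R) : R :=
  (Gamma al)^-1 *
  \int[lebesgue_measure]_(s in `[a, t]) ((t - s) `^ (al - 1) * phi s).

(* The iterates J^{k o al} g and I^{k o al} g, as functions of the upper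
   variable [t]; they differ only in the term k = 0. *)
Fixpoint Jiter (R : realType) (al : R) (g : R -> R) (k : nat) (a t : R) : R :=
  if k is k'.+1 then RLint al a (fun s => g s * Jiter al g k' a s) t
  else 1.

Fixpoint Iiter (R : realType) (al : R) (g : R -> R) (k : nat) (tau t : R) : R :=
  if k is k'.+1 then RLint al tau (fun s => g s * Iiter al g k' tau s) t
  else (t - tau) `^ (al - 1) / Gamma al.

(* \sum_(k >= 0) c k *: A ^+ k, summed entrywise. *)
Definition mxpow_series (R : realType) (d : nat) (A : 'M[R]_d) (c : R^nat) :
    'M[R]_d :=
  \matrix_(i, j) limn (series (fun k => c k * (A ^+ k) i j)).

(* State-transition matrices. *)
Definition Psi (R : realType) (d : nat) (al : R) (A : 'M[R]_d) (g : R -> R)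
    (a t : R) : 'M[R]_d :=
  mxpow_series A (fun k => Jiter al g k a t).

Definition Phi (R : realType) (d : nat) (al : R) (A : 'M[R]_d) (g : R -> R)
    (tau t : R) : 'M[R]_d :=
  mxpow_series A (fun k => Iiter al g k tau t).

Definition mxint (R : realType) (m n : nat) (D : set R)
    (F : R -> 'M[R]_(m, n)) : 'M[R]_(m, n) :=
  \matrix_(i, j) \int[lebesgue_measure]_(t in D) F t i j.

(* The solution of
     ^C D_t^al y(t) = A g(t) y(t) + B u(t) on [a, b],   y(a) = y0,
   corresponding to the control [u].  As [g] and [u] need not be regular, [y]
   need not be differentiable, and the problem is understood in the mild sense:
   its solution is the function given by the variation of constants formula. *)
Definition solution (R : realType) (d N : nat) (al a : R) (A : 'M[R]_d)
    (B : 'M[R]_(d, N)) (g : R -> R) (y0 : 'cV[R]_d) (u : R -> 'cV[R]_N)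
    (t : R) : 'cV[R]_d :=
  Psi al A g a t *m y0
  + mxint `[a, t] (fun tau => Phi al A g tau t *m B *m u tau).

(* Controls: the measurable functions on [a, b] for which the integral in
   [solution] exists (absolutely) at every time, so that it is not subject to
   the default value of the total integral. *)
Definition admissible (R : realType) (d N : nat) (al a b : R) (A : 'M[R]_d)
    (B : 'M[R]_(d, N)) (g : R -> R) (u : R -> 'cV[R]_N) : Prop :=
  (forall j, measurable_fun `[a, b] (fun t => u t j ord0)) /\
  (forall t, t \in `[a, b] -> forall i,
     lebesgue_measure.-integrable `[a, t]
       (EFin \o (fun tau => (Phi al A g tau t *m B *m u tau) i ord0))).

Definition controllable (R : realType) (d N : nat) (al a b : R) (A : 'M[R]_d)
    (B : 'M[R]_(d, N)) (g : R -> R) (y0 : 'cV[R]_d) : Prop :=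
  forall yb : 'cV[R]_d, exists u : R -> 'cV[R]_N,
    admissible al a b A B g u /\ solution al a A B g y0 u b = yb.

Definition gramian (R : realType) (d N : nat) (al a b : R) (A : 'M[R]_d)
    (B : 'M[R]_(d, N)) (g : R -> R) : 'M[R]_d :=
  mxint `[a, b] (fun t => (b - t) `^ (1 - al) *:
    (Phi al A g t b *m B *m B^T *m (Phi al A g t b)^T)).

(* Main.v *)
(* The iterates defining Phi are iterated Abel integrals. Measured with the
   weight (t - tau)^(al-1) exp(lam (t - tau)), each step multiplies the size of
   an iterate by a factor that is as small as desired when lam is large, so the
   series converges normally and |Phi(tau, t)| <= C (t - tau)^(al-1). Hence the
   integrand of the Gramian W is O((b - t)^(al-1)) and W is a genuine integral.
   If W is invertible, the control
     u(t) = (b - t)^(1-al) B^T Phi(t, b)^T W^-1 (yb - Psi(a, b) y0)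
   is bounded, hence admissible, and steers y0 to yb. If x W = 0 with x <> 0,
   then x W x^T = 0 is the integral of (b - t)^(1-al) |x Phi(t, b) B|^2, so
   x Phi(t, b) B = 0 almost everywhere and x y(b) is the same for all controls. *)
Require Import Defs.
From HB Require Import structures.
From mathcomp Require Import all_boot all_order all_algebra.
From mathcomp Require Import all_classical all_reals all_analysis.
From mathcomp Require Import measurable_realfun ring lra.
Import Order.TTheory GRing.Theory Num.Theory.
Import numFieldNormedType.Exports.
Local Open Scope classical_set_scope.
Local Open Scope ring_scope.

(** * Integrals over open intervals of nonnegative functions with a primitive *)

Lemma itvoo_exhaust {R : realType} (c d : R) : c < d ->
  \bigcup_n `[c + (d - c) / n.+3%:R, d - (d - c) / n.+3%:R]%classic
  = `]c, d[%classic.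
Proof.
move=> cd; have dc0 : 0 < d - c by rewrite subr_gt0.
have e0 n : 0 < (d - c) / n.+3%:R by rewrite divr_gt0.
apply/seteqP; split => [x [n _ /=]|x /=]; rewrite !in_itv/= => /andP[cx xd].
  by move: (e0 n) cx xd; set e := _ / _ => *; apply/andP; split; lra.
(* [e] is the distance from [x] to the nearer endpoint, and [n] is taken large enough that the
   margin (d - c) / (n + 3) is at most [e]. *)
pose e := Num.min (x - c) (d - x).
have e_gt0 : 0 < e by rewrite lt_min !subr_gt0 cx.
have ec : e <= x - c by rewrite ge_min lexx.
have ed : e <= d - x by rewrite ge_min lexx orbT.
pose n := Num.truncn ((d - c) / e).
have hn : (d - c) / n.+3%:R <= e.
  rewrite ler_pdivrMr// -ler_pdivrMl// mulrC (le_trans (ltW (truncnS_gt _)))//.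
  by rewrite ler_nat ltnS -addn2 leq_addr.
exists n => //=; rewrite in_itv/=; move: hn; set q := _ / _ => hn.
by apply/andP; split; lra.
Qed.

(** Monotone convergence along compact subintervals, on each of which the fundamental theorem of
    calculus applies. Hence [f] may blow up at [c] or [d], and a uniform bound on the increments of
    [F] is enough. *)
Lemma integral_itvoo_le_primitive {R : realType} (f F : R -> R) (c d V : R) :
  c < d -> (forall x, c < x < d -> {for x, continuous f}) ->
  (forall x, c < x < d -> is_derive x 1 F (f x)) ->
  (forall x, c < x < d -> 0 <= f x) ->
  (forall x y, c < x -> x < y -> y < d -> F y - F x <= V) ->
  (\int[lebesgue_measure]_(x in `]c, d[) (f x)%:E <= V%:E)%E.
Proof.
move=> cd cf dF f0 FV; have dc0 : 0 < d - c by rewrite subr_gt0.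
have e0 n : 0 < (d - c) / n.+3%:R by rewrite divr_gt0.
(* The shift to n + 3 keeps every margin strictly below half the length, so that each compact
   interval is nondegenerate. *)
have en n : (d - c) / n.+3%:R < (d - c) / 2.
  by rewrite ltr_pM2l// ltf_pV2 ?posrE// ltr_nat.
rewrite -itvoo_exhaust//.
set E : nat -> set R := fun n : nat => _.
have Esub n x : E n x -> c < x < d.
  rewrite /E/= in_itv/=; move: (e0 n); set e := _ / _ => ? /andP[? ?].
  by apply/andP; split; lra.
have cfE n : {within E n, continuous f}.
  apply: continuous_in_subspaceT => x; rewrite inE => /Esub; exact: cf.
have ndE : nondecreasing_seq E.
  move=> m n mn; apply/subsetPset/subset_itvScc; rewrite bnd_simp ?lerD2l ?lerN2;
    by rewrite ler_pM2l// lef_pV2 ?posrE// ler_nat !ltnS.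
have mE n : measurable (E n) by exact: measurable_itv.
have mfE n : measurable_fun (E n) (fun x => (f x)%:E).
  by apply/measurable_EFinP; exact: subspace_continuous_measurable_fun.
have fE0 n x : E n x -> (0 <= (f x)%:E)%E by move=> /Esub/f0; rewrite lee_fin.
have /cvg_lim <-// := ge0_nondecreasing_set_cvg_integral (mu := lebesgue_measure)
  ndE mE mfE fE0.
apply: lime_le.
  apply: ereal_nondecreasing_is_cvgn.
  exact: ge0_nondecreasing_set_nondecreasing_integral.
apply: nearW => n.
move: (en n) (e0 n) (@Esub n) (cfE n); rewrite /E; set e := _ / _ => En E0 Esubn cfn.
have lr : c + e < d - e by lra.
rewrite /= (@continuous_FTC2 _ f F)//.
- by rewrite -EFinB lee_fin; apply: FV => //; lra.

- have cF x : c < x < d -> F x @[x --> x] --> F x.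
    move=> /dF [? _]; apply/differentiable_continuous.
    exact/derivable1_diffP.
  split.
  + move=> x; rewrite in_itv/= => /andP[? ?].
    by have [|] := dF x; first by apply/andP; split; lra.
  + by apply: cvg_at_right_filter; apply: cF; apply/andP; split; lra.
  + by apply: cvg_at_left_filter; apply: cF; apply/andP; split; lra.
- move=> x; rewrite in_itv/= => /andP[? ?]; rewrite derive1E.
  by have [|] := dF x; first by apply/andP; split; lra.
Qed.

(** * Integrals of singular powers and of exponentials *)

Section power_integrals.
Context {R : realType}.
Implicit Types (al x c t tau s h lam : R).
Local Notation mu := (@lebesgue_measure R).

Lemma is_derive_powR_subr al c x : c < x ->
  is_derive x 1 (fun s => (s - c) `^ al) (al * (x - c) `^ (al - 1)).
Proof.
move=> cx; have xc0 : 0 < x - c by rewrite subr_gt0.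
have dx : is_derive x 1 (fun s => s - c) (1 - 0) by apply: is_deriveB.
have := is_derive1_comp (g := fun s => s - c) (is_derive1_powR al xc0) dx.
by rewrite /comp subr0 mulr1.
Qed.

Lemma is_derive_powR_subl al c x : x < c ->
  is_derive x 1 (fun s => (c - s) `^ al) (- (al * (c - x) `^ (al - 1))).
Proof.
move=> cx; have xc0 : 0 < c - x by rewrite subr_gt0.
have dx : is_derive x 1 (fun s => c - s) (0 - 1) by apply: is_deriveB.
have := is_derive1_comp (g := fun s => c - s) (is_derive1_powR al xc0) dx.
by rewrite /comp sub0r mulrN1.
Qed.

Lemma derive_continuous (f : R -> R) x l : is_derive x 1 f l -> {for x, continuous f}.
Proof.
by move=> [? _]; apply/differentiable_continuous/derivable1_diffP.
Qed.

Lemma integral_powR_subr_le al c h : 0 < al -> 0 < h ->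
  (\int[mu]_(s in `]c, (c + h)%R[) ((s - c) `^ (al - 1))%:E <= (h `^ al / al)%:E)%E.
Proof.
move=> al0 h0.
apply: (@integral_itvoo_le_primitive _ _ (fun s => al^-1 * (s - c) `^ al)).
- by rewrite ltrDl.
- by move=> x /andP[cx _]; exact: derive_continuous (is_derive_powR_subr _ _ _ cx).
- move=> x /andP[cx _]; have := is_derive_powR_subr al c x cx.
  move=> dp; apply: (is_derive_eq (is_deriveZ al^-1 dp)).
  by rewrite /GRing.scale/= mulrA mulVf ?mul1r// gt_eqF.
- by move=> x _; exact: powR_ge0.
- move=> x y cx xy yd; rewrite -mulrBr mulrC ler_pM2r ?invr_gt0//.
  have : (y - c) `^ al <= h `^ al by apply: ge0_ler_powR; rewrite ?nnegrE; lra.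
  by have := powR_ge0 (x - c) al; lra.
Qed.

Lemma integral_powR_subl_le al c h : 0 < al -> 0 < h ->
  (\int[mu]_(s in `](c - h)%R, c[) ((c - s) `^ (al - 1))%:E <= (h `^ al / al)%:E)%E.
Proof.
move=> al0 h0.
apply: (@integral_itvoo_le_primitive _ _ (fun s => - al^-1 * (c - s) `^ al)).
- lra.
- by move=> x /andP[_ cx]; exact: derive_continuous (is_derive_powR_subl _ _ _ cx).
- move=> x /andP[_ cx]; have := is_derive_powR_subl al c x cx.
  move=> dp; apply: (is_derive_eq (is_deriveZ (- al^-1) dp)).
  by rewrite /GRing.scale/= mulrNN mulrA mulVf ?mul1r// gt_eqF.
- by move=> x _; exact: powR_ge0.
- move=> x y cx xy yd; rewrite !mulNr opprK addrC -mulrBr mulrC ler_pM2r ?invr_gt0//.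
  have : (c - x) `^ al <= h `^ al by apply: ge0_ler_powR; rewrite ?nnegrE; lra.
  by have := powR_ge0 (c - y) al; lra.
Qed.

Lemma integral_expR_le lam tau t : 0 < lam -> tau < t ->
  (\int[mu]_(s in `]tau, t[) (expR (- lam * (t - s)))%:E <= (lam^-1)%:E)%E.
Proof.
move=> lam0 taut.
have dE x : is_derive x 1 (fun s => expR (- lam * (t - s)))
    (lam * expR (- lam * (t - x))).
  have dx : is_derive x 1 (fun s => - lam * (t - s)) (- lam *: (0 - 1)).
    by apply: is_deriveZ; apply: is_deriveB.
  have := is_derive1_comp (g := fun s => - lam * (t - s)) (is_derive_expR _) dx.
  by rewrite /comp sub0r scalerN scaleNr opprK /GRing.scale/= mulr1 mulrC.
apply: (@integral_itvoo_le_primitive _ _ (fun s => lam^-1 * expR (- lam * (t - s)))).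
- by [].
- by move=> x _; exact: derive_continuous (dE x).
- move=> x _; apply: (is_derive_eq (is_deriveZ lam^-1 (dE x))).
  by rewrite /GRing.scale/= mulrA mulVf ?mul1r// gt_eqF.
- by move=> x _; exact: expR_ge0.
- move=> x y cx xy yd; rewrite -mulrBr mulrC ler_piMl ?invr_ge0 ?ltW//.
  have : expR (- lam * (t - y)) <= 1.
    by rewrite -expR0 ler_expR mulNr oppr_le0 mulr_ge0//; lra.
  by have := expR_gt0 (- lam * (t - x)); lra.
Qed.

End power_integrals.

(** * Smallness of the Abel kernel with respect to an exponential weight *)

Section abel_kernel.
Context {R : realType}.
Implicit Types (al lam del q u v t tau : R).
Local Notation mu := (@lebesgue_measure R).

Lemma powR_nincr (r u v : R) : r <= 0 -> 0 < u -> u <= v -> v `^ r <= u `^ r.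
Proof.
move=> r0 u0 uv; have v0 : 0 < v by exact: lt_le_trans uv.
by rewrite /powR !gt_eqF// ler_expR ler_wnM2l// ler_ln.
Qed.

(** The larger of [u] and [v] is at least (u + v) / 2, so its power is at most 2^(-r) (u + v)^r; the
    power of the other one is a summand of the last factor. *)
Lemma powR_mul_le (r u v : R) : r <= 0 -> 0 < u -> 0 < v ->
  u `^ r * v `^ r <= 2 `^ (- r) * (u + v) `^ r * (u `^ r + v `^ r).
Proof.
move=> r0 u0 v0.
have half_ge w : (u + v) / 2 <= w -> w `^ r <= 2 `^ (- r) * (u + v) `^ r.
  move=> hw; apply: le_trans (powR_nincr _ _ _ r0 _ hw) _; first by lra.
  rewrite powRM; [|lra|lra].
  by rewrite -powR_inv1// -powRrM mulN1r mulrC.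
have [pu pv] := (powR_ge0 u r, powR_ge0 v r).
rewrite mulrDr; have [uv|/ltW vu] := leP u v.
- have /(ler_wpM2l pu) := half_ge v ltac:(lra).
  move/le_trans; apply; rewrite mulrC lerDl.
  by rewrite !mulr_ge0 ?powR_ge0.
- have /(ler_wpM2r pv) := half_ge u ltac:(lra).
  move/le_trans; apply; rewrite lerDr.
  by rewrite !mulr_ge0 ?powR_ge0.
Qed.

(** Used with u = s - tau and v = t - s, so that u + v = t - tau does not depend on the integration
    variable. Writing exp(lam u) = exp(lam (u + v)) exp(- lam v) factors out the weight at u + v,
    and [powR_mul_le] separates the two singularities. *)
Lemma abel_kernel_pointwise al lam del u v : al < 1 -> 0 < lam -> 0 < del ->
  0 < u -> 0 < v ->
  v `^ (al - 1) * (u `^ (al - 1) * expR (lam * u)) <=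
  2 `^ (1 - al) * ((u + v) `^ (al - 1) * expR (lam * (u + v))) *
  ((if u < del then u `^ (al - 1) else 0) +
   (if v < del then v `^ (al - 1) else 0) +
   2 * del `^ (al - 1) * expR (- lam * v)).
Proof.
move=> al1 lam0 del0 u0 v0; set r := al - 1.
have r0 : r <= 0 by rewrite /r; lra.
have -> : 1 - al = - r by rewrite /r; lra.
have -> : expR (lam * u) = expR (lam * (u + v)) * expR (- lam * v).
  by rewrite -expRD; congr expR; lra.
set E := expR (lam * (u + v)); set e := expR (- lam * v).
have E0 : 0 <= E by exact: expR_ge0.
have e0 : 0 <= e by exact: expR_ge0.
have e1 : e <= 1 by rewrite /e -expR0 ler_expR mulNr oppr_le0 mulr_ge0// ltW.
have := powR_mul_le r u v r0 u0 v0.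
set c := 2 `^ (- r) * (u + v) `^ r => uvc.
have c0 : 0 <= c by rewrite mulr_ge0 ?powR_ge0.
have -> : v `^ r * (u `^ r * (E * e)) = E * (e * (u `^ r * v `^ r)) by ring.
have -> : 2 `^ (- r) * ((u + v) `^ r * E) = E * c by rewrite /c; ring.
rewrite -[leRHS]mulrA ler_wpM2l//; apply: le_trans (ler_wpM2l e0 uvc) _.
rewrite mulrCA ler_wpM2l//.
(* Near 0 the exponential is bounded by 1; away from 0 the power is bounded by its value at [del]
   and the exponential is kept. *)
have cut w : 0 < w -> e * w `^ r <= (if w < del then w `^ r else 0) + del `^ r * e.
  move=> w0; case: ltP => wdel.
    have := ler_wpM2r (powR_ge0 w r) e1; rewrite mul1r => ew.
    by have := mulr_ge0 (powR_ge0 del r) e0; lra.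
  by rewrite add0r mulrC ler_wpM2r//; exact: powR_nincr.
have cu := cut u u0; have cv := cut v v0.
move: cu cv; case: ifP => _; case: ifP => _; lra.
Qed.

(* In [abel_kernel_pointwise], each singular power is cut off at distance [del]:
   the near part has integral [del `^ al / al], and the far part is bounded by
   [del `^ (al - 1)], whose integral against the exponential is O(1 / lam). *)
Lemma abel_kernel_contraction al q : 0 < al -> al < 1 -> 0 < q ->
  exists2 lam, 0 < lam & forall tau t, tau <= t ->
  (\int[mu]_(s in `[tau, t]) ((t - s) `^ (al - 1) *
     ((s - tau) `^ (al - 1) * expR (lam * (s - tau))))%:E <=
   (q * ((t - tau) `^ (al - 1) * expR (lam * (t - tau))))%:E)%E.
Proof.
move=> al0 al1 q0.
have two0 : 0 < 2 `^ (1 - al) :> R by exact: powR_gt0.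
(* [del] solves the equation under which the two near parts together contribute q / 2; once [del] is
   fixed, [lam] is chosen so that the far part contributes the other q / 2. *)
pose del := (q * al / (4 * 2 `^ (1 - al))) `^ al^-1.
have del0 : 0 < del by apply: powR_gt0; rewrite divr_gt0 ?mulr_gt0.
have delal : 2 `^ (1 - al) * (2 * (del `^ al / al)) = q / 2.
  rewrite /del -powRrM mulVf ?gt_eqF// powRr1; last first.
    by rewrite ltW// divr_gt0 ?mulr_gt0.
  by field; rewrite !gt_eqF.
have d0 : 0 < del `^ (al - 1) by exact: powR_gt0.
pose lam := 2 `^ (1 - al) * (4 * del `^ (al - 1)) / q.
have lam0 : 0 < lam by rewrite divr_gt0 ?mulr_gt0.
have lamq : 2 `^ (1 - al) * (2 * del `^ (al - 1) * lam^-1) = q / 2.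
  by rewrite /lam; field; rewrite !gt_eqF.
exists lam => // tau t; rewrite le_eqVlt => /predU1P[<-|taut].
  by rewrite set_itv1 integral_set1 lee_fin !mulr_ge0 ?powR_ge0 ?expR_ge0// ltW.
pose C := 2 `^ (1 - al) * ((t - tau) `^ (al - 1) * expR (lam * (t - tau))).
have C0 : 0 <= C by rewrite !mulr_ge0 ?powR_ge0 ?expR_ge0.
pose D := 2 * del `^ (al - 1).
have D0 : 0 <= D by rewrite mulr_ge0 ?powR_ge0.
(* Extended by zero, the three bounds can be added under one integral over the line. The supports of
   [p1] and [p2] may leave [[tau, t]], which only enlarges the bound. *)
pose p1 := (fun s : R => ((s - tau) `^ (al - 1))%:E) \_ `]tau, tau + del[%classic.
pose p2 := (fun s : R => ((t - s) `^ (al - 1))%:E) \_ `]t - del, t[%classic.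
pose p3 := (fun s : R => (expR (- lam * (t - s)))%:E) \_ `]tau, t[%classic.
have mpow (f : R -> R) : measurable_fun setT f ->
    measurable_fun setT (fun s => (f s `^ (al - 1))%:E).
  by move=> mf; apply/measurable_EFinP; exact: measurableT_comp (measurable_powR _) mf.
have mexp (f : R -> R) : measurable_fun setT f ->
    measurable_fun setT (fun s => (expR (f s))%:E).
  by move=> mf; apply/measurable_EFinP; exact: (measurableT_comp (@measurable_expR _) mf).
have mp1 : measurable_fun setT p1.
  apply/(measurable_restrictT _ _).1 => //; apply: measurable_funTS; apply: (mpow (fun s => s - tau)).
  exact: measurable_funB.
have mp2 : measurable_fun setT p2.
  apply/(measurable_restrictT _ _).1 => //; apply: measurable_funTS; apply: (mpow (fun s => t - s)).
  exact: measurable_funB.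
have mp3 : measurable_fun setT p3.
  apply/(measurable_restrictT _ _).1 => //; apply: measurable_funTS; apply: (mexp (fun s => - lam * (t - s))).
  by apply: measurable_funM => //; exact: measurable_funB.
have p10 s : (0 <= p1 s)%E by apply: erestrict_ge0 => x _; rewrite lee_fin powR_ge0.
have p20 s : (0 <= p2 s)%E by apply: erestrict_ge0 => x _; rewrite lee_fin powR_ge0.
have p30 s : (0 <= p3 s)%E by apply: erestrict_ge0 => x _; rewrite lee_fin expR_ge0.
have mD : measurable_fun setT (fun s => D%:E * p3 s)%E.
  exact: measurable_funeM.
have m12 : measurable_fun setT (fun s => p1 s + p2 s)%E.
  exact: emeasurable_funD.
have m123 : measurable_fun setT (fun s => p1 s + p2 s + D%:E * p3 s)%E.
  exact: emeasurable_funD.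
have D30 s : (0 <= D%:E * p3 s)%E by rewrite mule_ge0.
have s0 s : (0 <= p1 s + p2 s + D%:E * p3 s)%E by rewrite !adde_ge0.
apply: (@le_trans _ _ (\int[mu]_s (C%:E * (p1 s + p2 s + D%:E * p3 s)))%E).
  rewrite [leLHS]integral_mkcond; apply: ge0_le_integral => //.
  - by move=> s _; apply: erestrict_ge0 => x _; rewrite lee_fin !mulr_ge0 ?powR_ge0 ?expR_ge0.
  - apply/(measurable_restrictT _ _).1 => //; apply: measurable_funTS.
    apply/measurable_EFinP; apply: measurable_funM.
      by apply/measurable_EFinP; apply: (mpow (fun s => t - s)); exact: measurable_funB.
    apply: measurable_funM.
      by apply/measurable_EFinP; apply: (mpow (fun s => s - tau)); exact: measurable_funB.
    apply/measurable_EFinP; apply: (mexp (fun s => lam * (s - tau))).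
    by apply: measurable_funM => //; exact: measurable_funB.
  - exact: measurable_funeM.
  - move=> s _; rewrite patchE; case: ifPn => [|_]; last by rewrite mule_ge0.
    rewrite inE/= in_itv/= => /andP[taus st].
    (* At s = tau and s = t the kernel is 0, because 0 raised to the nonzero exponent al - 1 is 0 by
       convention. *)
    have := taus; rewrite le_eqVlt => /predU1P[es|taus'].
      by rewrite -{2}es subrr powR0 ?mul0r ?mulr0 ?mule_ge0// subr_eq0 lt_eqF.
    have := st; rewrite le_eqVlt => /predU1P[es|st'].
      by rewrite es subrr powR0 ?mul0r ?mule_ge0// subr_eq0 lt_eqF.
    have := @abel_kernel_pointwise al lam del (s - tau) (t - s) al1 lam0 del0.
    rewrite !subr_gt0 => /(_ taus' st').
    have -> : s - tau + (t - s) = t - tau by lra.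
    rewrite -/C -/D -lee_fin => /le_trans; apply.
    rewrite EFinM lee_wpmul2l//; rewrite !EFinD EFinM.
    apply: leeD; first apply: leeD.
    + rewrite /p1 patchE mem_setE in_itv/= taus'/= ltrBlDl.
      by case: ifP.
    + rewrite /p2 patchE mem_setE in_itv/= st' andbT ltrBlDl -ltrBlDr.
      by case: ifP.
    + by rewrite /p3 patchE mem_setE in_itv/= taus' st'.
rewrite ge0_integralZl// ge0_integralD//; last by move=> s _; rewrite adde_ge0.
rewrite ge0_integralD// ge0_integralZl//.
rewrite /p1 /p2 /p3 -!integral_mkcond.
have i1 := @integral_powR_subr_le R al tau del al0 del0.
have i2 := @integral_powR_subl_le R al t del al0 del0.
have i3 := @integral_expR_le R lam tau t lam0 taut.
apply: (@le_trans _ _ (C%:E * ((del `^ al / al)%:E + (del `^ al / al)%:E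
                               + D%:E * (lam^-1)%:E)))%E.
  by rewrite lee_wpmul2l// leeD ?leeD// lee_wpmul2l.
rewrite -!(EFinM, EFinD) lee_fin /C /D.
set X := _ `^ _ * expR _.
have -> : 2 `^ (1 - al) * X * (del `^ al / al + del `^ al / al +
   2 * del `^ (al - 1) * lam^-1) = X * (2 `^ (1 - al) * (2 * (del `^ al / al)) +
   2 `^ (1 - al) * (2 * del `^ (al - 1) * lam^-1)) by ring.
by rewrite delal lamq; lra.
Qed.

End abel_kernel.

(** * Measurability and bounds for the iterates and for [Phi] *)

Section state_transition.
Context {R : realType}.
Implicit Types (al lam q t tau s : R) (g : R -> R).
Local Notation mu := (@lebesgue_measure R).

(** Tonelli applies to the positive and the negative part separately, and [fine] is measurable;
    parameters at which the integral diverges are thus covered too. *)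
Lemma measurable_Rintegral_param d (T : measurableType d) (f : T * R -> R) :
  measurable_fun setT f ->
  measurable_fun setT (fun x => \int[mu]_s f (x, s)).
Proof.
move=> mf; pose h : T * R -> \bar R := EFin \o f.
have mh : measurable_fun setT h by exact/measurable_EFinP.
have -> : (fun x => \int[mu]_s f (x, s)) =
    fine \o (fun x => (\int[mu]_s h^\+ (x, s) - \int[mu]_s h^\- (x, s))%E).
  apply/funext => x; rewrite /Rintegral integralE /=; congr (fine (_ - _)%E).
    by apply: eq_integral => s _; exact: (congr1 (@^~ s) (funepos_comp h (pair x))).
  by apply: eq_integral => s _; exact: (congr1 (@^~ s) (funeneg_comp h (pair x))).
apply: (measurableT_comp (fine_measurable measurableT)) => //.
apply: emeasurable_funB.
  apply: (measurable_fun_fubini_tonelli_F (m2 := mu) h^\+%E) => //.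
  exact: measurable_funepos.
apply: (measurable_fun_fubini_tonelli_F (m2 := mu) h^\-%E) => //.
exact: measurable_funeneg.
Qed.

(** Joint measurability is the form that survives the induction: the recursion integrates over the
    second variable, whereas [Phi] is later integrated over the first. *)
Lemma measurable_Iiter al g k : measurable_fun setT g ->
  measurable_fun setT (fun p : R * R => Iiter al g k p.1 p.2).
Proof.
move=> mg; have mpow d (T : measurableType d) (u v : T -> R) :
    measurable_fun setT u -> measurable_fun setT v ->
    measurable_fun setT (fun x => (u x - v x) `^ (al - 1)).
  move=> mu' mv; apply: (measurableT_comp (measurable_powR _)).
  exact: measurable_funB.
elim: k => [|k IH] /=; first by apply: measurable_funM => //; exact: mpow.
apply: measurable_funM => //.
(* The variable limits of integration are moved into the integrand, which gives an integral over the
   line with parameter (tau, t). *)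
pose f (y : (R * R) * R) := if (y.1.1 <= y.2) && (y.2 <= y.1.2) then
  (y.1.2 - y.2) `^ (al - 1) * (g y.2 * Iiter al g k y.1.1 y.2) else 0.
have m1 : measurable_fun setT (fun y : (R * R) * R => y.1.1).
  exact: (measurableT_comp measurable_fst measurable_fst).
have m2 : measurable_fun setT (fun y : (R * R) * R => y.1.2).
  exact: (measurableT_comp measurable_snd measurable_fst).
have m3 : measurable_fun setT (fun y : (R * R) * R => y.2) by exact: measurable_snd.
have mf : measurable_fun setT f.
  apply: measurable_fun_ifT => //.
    by apply: measurable_and; exact: measurable_fun_ler.
  apply: measurable_funM; first exact: mpow.
  apply: measurable_funM; first exact: (measurableT_comp mg).
  exact: (measurableT_comp IH (measurable_fun_pair m1 m3)).
apply: eq_measurable_fun (measurable_Rintegral_param _ _ _ mf) => -[tau t] _ /=.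
rewrite [RHS]Rintegral_mkcond; apply: eq_Rintegral => s _.
by rewrite patchE mem_setE in_itv.
Qed.

(** This permits replacing [g], controlled on [[a, b]] only, by its extension by zero, which is
    measurable and bounded on the whole line. *)
Lemma eq_Iiter al g h k tau t : (forall s, tau <= s <= t -> g s = h s) ->
  Iiter al g k tau t = Iiter al h k tau t.
Proof.
elim: k t => [//|k IH] t gh /=; congr (_ * _).
apply: eq_Rintegral => s; rewrite inE/= in_itv/= => /andP[taus st].
rewrite gh ?taus// IH// => r /andP[taur rs].
by apply: gh; rewrite taur (le_trans rs).
Qed.

(** Each application of [RLint] costs the factor 1 / Gamma(al), the bound [M] of [g] and, by the
    contraction hypothesis, [q], while it reproduces the same weight. For k = 0 the exponential is
    at least 1. *)
Lemma Iiter_le al g (M q lam : R) : measurable_fun setT g ->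
  (forall s, `|g s| <= M) -> 0 <= q ->
  (forall tau t, tau <= t ->
    (\int[mu]_(s in `[tau, t]) ((t - s) `^ (al - 1) *
     ((s - tau) `^ (al - 1) * expR (lam * (s - tau))))%:E <=
     (q * ((t - tau) `^ (al - 1) * expR (lam * (t - tau))))%:E)%E) ->
  0 <= lam ->
  forall k tau t, tau <= t ->
  `|Iiter al g k tau t| <= `|(Gamma al)^-1| * (`|(Gamma al)^-1| * M * q) ^+ k *
     ((t - tau) `^ (al - 1) * expR (lam * (t - tau))).
Proof.
move=> mg gM q0 contr lam0; elim=> [|k IH] tau t taut /=.
  rewrite expr0 mulr1 normrM mulrC ler_wpM2l//.
  rewrite ger0_norm ?powR_ge0// ler_peMr ?powR_ge0//.
  by rewrite -expR0 ler_expR mulr_ge0// subr_ge0.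
have M0 : 0 <= M by exact: le_trans (gM 0).
set G := `|_^-1| in IH *; set K := G * _ in IH *.
have G0 : 0 <= G by exact: normr_ge0.
have K0 : 0 <= K by rewrite mulr_ge0 ?exprn_ge0 ?mulr_ge0.
rewrite normrM -/G.
have -> : G * (G * M * q) ^+ k.+1 = G * (M * K) * q by rewrite /K exprS; ring.
clearbody K.
rewrite -!mulrA ler_wpM2l//.
have mf : measurable_fun `[tau, t] (fun s =>
    (t - s) `^ (al - 1) * (g s * Iiter al g k tau s)).
  apply: measurable_funTS; apply: measurable_funM.
    apply: (measurableT_comp (measurable_powR _)); exact: measurable_funB.
  apply: measurable_funM => //.
  exact: (measurable_fun_pair2 tau (measurable_Iiter al g k mg)).
pose ker s := (t - s) `^ (al - 1) *
  ((s - tau) `^ (al - 1) * expR (lam * (s - tau))).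
have ker0 s : 0 <= ker s by rewrite !mulr_ge0 ?powR_ge0 ?expR_ge0.
have mker : measurable_fun `[tau, t] ker.
  apply: measurable_funTS; apply: measurable_funM.
    apply: (measurableT_comp (measurable_powR _)); exact: measurable_funB.
  apply: measurable_funM.
    apply: (measurableT_comp (measurable_powR _)); exact: measurable_funB.
  apply: (measurableT_comp (@measurable_expR _)); apply: measurable_funM => //.
  exact: measurable_funB.
have fin_le (x : \bar R) r : (`|x| <= r%:E)%E -> `|fine x| <= r.
  by case: x => [x||] /=; rewrite ?lee_fin// leye_eq.
apply: fin_le; apply: le_trans.
  by apply: le_abse_integral => //; exact/measurable_EFinP.
apply: (@le_trans _ _ (\int[mu]_(s in `[tau, t]) ((M * K)%:E * (ker s)%:E))%E).
  apply: ge0_le_integral => //.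
  - by apply/measurable_EFinP; exact: measurableT_comp.
  - by apply: measurable_funeM; exact/measurable_EFinP.
  - move=> s /=; rewrite in_itv/= => /andP[taus st].
    rewrite lee_fin !normrM (ger0_norm (powR_ge0 _ _)) /ker.
    rewrite [leRHS]mulrCA ler_wpM2l ?powR_ge0// -mulrA ler_pM//.
    exact: IH.
rewrite ge0_integralZl//; [|exact/measurable_EFinP|by move=> s _; rewrite lee_fin|by rewrite lee_fin mulr_ge0].
apply: le_trans (lee_wpmul2l _ (contr _ _ taut)) _; first by rewrite lee_fin mulr_ge0.
by rewrite -EFinM lee_fin !mulrA.
Qed.

(** The base dominates every absolute row sum of [A], so the entrywise bound passes from one power
    to the next. The summand 1 makes the base positive, which allows dividing by it later. *)
Lemma mx_exp_le d (A : 'M[R]_d) k i j :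
  `|(A ^+ k) i j| <= (1 + \sum_i \sum_j `|A i j|) ^+ k.
Proof.
set rho := 1 + _; have S0 : 0 <= \sum_i \sum_j `|A i j|.
  by rewrite sumr_ge0// => *; rewrite sumr_ge0.
have rho0 : 0 <= rho by rewrite addr_ge0.
elim: k i j => [|k IH] i j.
  by rewrite !expr0 mxE; case: eqP => _; rewrite ?normr1 ?normr0.
rewrite exprS mxE; apply: le_trans (ler_norm_sum _ _ _) _.
apply: (@le_trans _ _ (\sum_l `|A i l| * rho ^+ k)).
  by apply: ler_sum => l _; rewrite normrM ler_wpM2l.
rewrite -mulr_suml exprS ler_wpM2r ?exprn_ge0//.
rewrite /rho [X in _ <= _ + X](bigD1 i)//= addrCA lerDl addr_ge0// sumr_ge0// => l _.
by rewrite sumr_ge0.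
Qed.

(** The series is dominated by a geometric one whose first term carries the singularity;
    measurability in [tau] follows since [Phi] is a pointwise limit of measurable partial sums. *)
Lemma Phi_spec d al a b (A : 'M[R]_d) g : 0 < al -> al < 1 ->
  {within `[a, b], continuous g} ->
  exists C, [/\ 0 <= C,
    forall tau t i j, a <= tau -> tau <= t -> t <= b ->
      `|Phi al A g tau t i j| <= C * (t - tau) `^ (al - 1) &
    forall t i j, t <= b ->
      measurable_fun `[a, t] (fun tau => Phi al A g tau t i j)].
Proof.
move=> al0 al1 cg.
pose h := g \_ `[a, b]%classic.
have mh : measurable_fun setT h.
  apply/(measurable_restrictT _ _).1 => //.
  exact: subspace_continuous_measurable_fun.
have [M hM] : exists M, forall s, `|h s| <= M.
  have [M [Mr HM]] := compact_bounded (continuous_compact cg (@segment_compact _ a b)).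
  exists (Num.max 0 (M + 1)) => s; rewrite /h patchE; case: ifPn => [|_].
    rewrite inE => sab; rewrite le_max; apply/orP; right.
    by apply: (HM (M + 1)); [rewrite ltrDl|exists s].
  by rewrite normr0 le_max lexx.
have M0 : 0 <= M by exact: le_trans (hM 0).
set rho := 1 + \sum_i \sum_j `|A i j|.
have rho0 : 0 < rho.
  by rewrite ltr_wpDr// sumr_ge0// => *; rewrite sumr_ge0.
set G := `|(Gamma al)^-1|.
(* Chosen so that the ratio rho G M q is at most 1/2; the added 1 keeps the denominator positive
   when G M = 0. *)
pose q := (2 * rho * (G * M + 1))^-1.
have G0 : 0 <= G by exact: normr_ge0.
have GM0 : 0 <= G * M by rewrite mulr_ge0.
have q0 : 0 < q by rewrite invr_gt0 !mulr_gt0// ltr_wpDl.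
have qhalf : rho * (G * M * q) <= 2^-1.
  have GM1 : 0 < G * M + 1 by rewrite ltr_wpDl.
  rewrite (_ : rho * (G * M * q) = 2^-1 * (G * M / (G * M + 1))); last first.
    by rewrite /q; field; rewrite !gt_eqF.
  by rewrite ler_piMr// ler_pdivrMr// mul1r lerDl.
have [lam lam0 contr] := abel_kernel_contraction al q al0 al1 q0.
(* On [[a, b]] the exponential weight is bounded by this constant and disappears from the final
   estimate. *)
pose E := expR (lam * (b - a)).
have E0 : 0 <= E by exact: expR_ge0.
have term tau t i j k : a <= tau -> tau <= t -> t <= b ->
    `|Iiter al g k tau t * (A ^+ k) i j| <=
    geometric (G * E * (t - tau) `^ (al - 1)) 2^-1 k.
  move=> atau taut tb.
  have -> : Iiter al g k tau t = Iiter al h k tau t.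
    apply: eq_Iiter => s /andP[taus st]; rewrite /h patchE mem_set//=.
    by rewrite in_itv/= (le_trans atau)// (le_trans st).
  rewrite normrM.
  have I1 := Iiter_le al h M q lam mh hM (ltW q0) contr (ltW lam0) k tau t taut.
  have A1 := mx_exp_le d A k i j.
  apply: (le_trans (ler_pM (normr_ge0 _) (normr_ge0 _) I1 A1)).
  rewrite -/rho -/G /geometric/=.
  set p := (t - tau) `^ _; have p0 : 0 <= p by exact: powR_ge0.
  set e := expR _; have e0 : 0 <= e by exact: expR_ge0.
  have eE : e <= E by rewrite ler_expR ler_pM2l//; lra.
  have -> : G * (G * M * q) ^+ k * (p * e) * rho ^+ k =
      G * e * p * (rho * (G * M * q)) ^+ k by rewrite [in RHS]exprMn; ring.
  rewrite ler_pM ?mulr_ge0 ?exprn_ge0// ?mulr_ge0//; [exact: ltW|exact: ltW| |].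
    by rewrite ler_wpM2r// ler_wpM2l.
  by rewrite lerXn2r ?nnegrE// mulr_ge0 ?(ltW rho0)// mulr_ge0// ltW.
have half1 : `|2^-1 : R| < 1 by rewrite ger0_norm// invf_lt1// ltr1n.
have cvn tau t i j : a <= tau -> tau <= t -> t <= b ->
    cvgn [normed series (fun k => Iiter al g k tau t * (A ^+ k) i j)].
  move=> atau taut tb; have T k := term tau t i j k atau taut tb.
  apply: (@series_le_cvg _ _ (geometric (G * E * (t - tau) `^ (al - 1)) 2^-1)) => //.
  - by move=> k; exact: normr_ge0.
  - by move=> k; exact: le_trans (normr_ge0 _) (T k).
  - exact: is_cvg_geometric_series.
exists (G * E / (1 - 2^-1)); split.
- by rewrite divr_ge0 ?mulr_ge0//; lra.
- move=> tau t i j atau taut tb; rewrite mxE.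
  have cvt := cvn tau t i j atau taut tb.
  apply: (le_trans (lim_series_norm cvt)).
  have gc := cvg_geometric_series (a := G * E * (t - tau) `^ (al - 1)) half1.
  apply: (@le_trans _ _ (limn (series (geometric (G * E * (t - tau) `^ (al - 1)) 2^-1)))).
    apply: lim_series_le => //.
      exact: is_cvg_geometric_series.
    by move=> k; exact: term.
  by rewrite (cvg_lim _ gc)// mulrAC.
- move=> t i j tb.
  apply: (@measurable_fun_cvg _ _ _ _
    (fun m tau => series (fun k => Iiter al g k tau t * (A ^+ k) i j) m)).
    move=> m; apply: measurable_sum => k; apply: measurable_funM => //.
    have mk := measurable_fun_pair1 t (measurable_Iiter al h k mh).
    apply: eq_measurable_fun (measurable_funTS mk) => tau.
    rewrite inE/= in_itv/= => /andP[atau taut]; apply: eq_Iiter => s /andP[taus st].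
    by rewrite /h patchE mem_set//= in_itv/= (le_trans atau)// (le_trans st).
  move=> tau /=; rewrite in_itv/= => /andP[atau taut]; rewrite mxE.
  exact/normed_cvg/cvn.
Qed.

End state_transition.

(** * Integrability criteria and integrals of matrix-valued functions *)

Section controllability.
Context {R : realType}.
Local Notation mu := (@lebesgue_measure R).

(** The singularity at [t] is integrable because its exponent exceeds -1. As the sign of [K] is
    free, the dominating function uses its absolute value. *)
Lemma integrable_le_powR (al a t K : R) (f : R -> R) : 0 < al -> a <= t ->
  measurable_fun `[a, t] f ->
  (forall s, s \in `[a, t] -> `|f s| <= K * (t - s) `^ (al - 1)) ->
  mu.-integrable `[a, t] (EFin \o f).
Proof.
move=> al0 leat mf fK; have mK (D : set R) : measurable_fun D
    (fun s => (`|K| * (t - s) `^ (al - 1))%:E).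
  apply: measurable_funTS; apply/measurable_EFinP; apply: measurable_funM => //.
  by apply: (measurableT_comp (measurable_powR _)); exact: measurable_funB.
apply/integrableP; split; first exact/measurable_EFinP.
apply: (@le_lt_trans _ _
    (\int[mu]_(s in `[a, t]) (`|K| * (t - s) `^ (al - 1))%:E)%E).
  apply: ge0_le_integral => //.
  - by apply: measurableT_comp => //; exact/measurable_EFinP.
  - exact: mK.
  move=> s /= st; rewrite lee_fin (le_trans (fK s st))// ler_wpM2r ?powR_ge0//.
  exact: ler_norm.
move: leat; rewrite le_eqVlt => /predU1P[<-|at_].
  by rewrite set_itv1 integral_set1.
rewrite (integral_itv_bndoo true false)//.
under eq_integral do rewrite EFinM.
rewrite ge0_integralZl//; last 2 first.
- apply: measurable_funTS; apply/measurable_EFinP.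
  by apply: (measurableT_comp (measurable_powR _)); exact: measurable_funB.
- by move=> s _; rewrite lee_fin powR_ge0.
have ta0 : 0 < t - a by rewrite subr_gt0.
have := @integral_powR_subl_le R al t (t - a) al0 ta0.
rewrite opprB addrCA subrr addr0 => le_int.
apply: le_lt_trans (lee_wpmul2l _ le_int) _; first by rewrite lee_fin.
by rewrite -EFinM ltry.
Qed.

(** The product is 1 for r > 0 but 0 at r = 0, where both powers vanish by convention; hence an
    inequality. *)
Lemma powR_mulN_le1 (p r : R) : 0 <= r -> p != 0 -> r `^ (- p) * r `^ p <= 1.
Proof.
rewrite le_eqVlt => /predU1P[<-|r0] p0; first by rewrite !powR0 ?oppr_eq0// mul0r.
by rewrite -powRD ?(gt_eqF r0) ?implybT// addNr powRr0.
Qed.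

Lemma measurable_mulmx (D : set R) m n p (F : R -> 'M[R]_(m, n))
    (G : R -> 'M[R]_(n, p)) :
  (forall i j, measurable_fun D (fun t => F t i j)) ->
  (forall i j, measurable_fun D (fun t => G t i j)) ->
  forall i j, measurable_fun D (fun t => (F t *m G t) i j).
Proof.
move=> mF mG i j; under eq_fun do rewrite mxE.
by apply: measurable_sum => k; exact: measurable_funM.
Qed.

Lemma measurable_scalemx (D : set R) m n (c : R -> R) (F : R -> 'M[R]_(m, n)) :
  measurable_fun D c -> (forall i j, measurable_fun D (fun t => F t i j)) ->
  forall i j, measurable_fun D (fun t => (c t *: F t) i j).
Proof.
move=> mc mF i j.
have -> : (fun t => (c t *: F t) i j) = (fun t => c t * F t i j).
  by apply/funext => t; rewrite mxE.
exact: measurable_funM.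
Qed.

Lemma measurable_trmx (D : set R) m n (F : R -> 'M[R]_(m, n)) :
  (forall i j, measurable_fun D (fun t => F t i j)) ->
  forall i j, measurable_fun D (fun t => (F t)^T i j).
Proof.
move=> mF i j.
by have -> : (fun t => (F t)^T i j) = (fun t => F t j i)
  by apply/funext => t; rewrite mxE.
Qed.

Lemma mulmx_entry_le m n p (F : 'M[R]_(m, n)) (G : 'M[R]_(n, p)) (c e : R) :
  0 <= c ->
  (forall i j, `|F i j| <= c) -> (forall i j, `|G i j| <= e) ->
  forall i j, `|(F *m G) i j| <= n%:R * (c * e).
Proof.
move=> c0 Fc Ge i j; rewrite mxE; apply: le_trans (ler_norm_sum _ _ _) _.
apply: (@le_trans _ _ (\sum_(k < n) c * e)).
  by apply: ler_sum => k _; rewrite normrM ler_pM.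
by rewrite sumr_const card_ord mulr_natl.
Qed.

Lemma mx_entry_bounded m n (B : 'M[R]_(m, n)) :
  exists2 K, 0 <= K & forall i j, `|B i j| <= K.
Proof.
exists (\sum_i \sum_j `|B i j|).
  by rewrite sumr_ge0// => *; rewrite sumr_ge0.
move=> i j; rewrite (bigD1 i)//= (bigD1 j)//= -addrA lerDl addr_ge0//.
  by rewrite sumr_ge0.
by rewrite sumr_ge0// => *; rewrite sumr_ge0.
Qed.

(** Integrability makes every summand finite, so [fine] commutes with the sum. *)
Lemma Rintegral_sum d (T : measurableType d) (nu : {measure set T -> \bar R})
    (D : set T) (n : nat) (f : 'I_n -> T -> R) :
  measurable D -> (forall i, nu.-integrable D (EFin \o f i)) ->
  \int[nu]_(t in D) (\sum_i f i t) = \sum_i \int[nu]_(t in D) f i t.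
Proof.
move=> mD fi; rewrite /Rintegral.
under eq_integral do rewrite -sumEFin.
rewrite (integral_sum mD fi).
rewrite -[RHS]/(fine (\sum_i fine (\int[nu]_(t in D) (f i t)%:E))%:E) -sumEFin.
by congr fine; apply: eq_bigr => i _; rewrite fineK//; exact: (integrable_fin_num mD (fi i)).
Qed.

Lemma integrable_mulmxl (D : set (measurableTypeR R)) m n p (X : 'M[R]_(p, m))
    (F : R -> 'M[R]_(m, n)) : measurable D ->
  (forall i j, mu.-integrable D (EFin \o (fun t => F t i j))) ->
  forall i j, mu.-integrable D (EFin \o (fun t => (X *m F t) i j)).
Proof.
move=> mD Fi i j; rewrite /comp; under eq_fun do rewrite mxE -sumEFin.
apply: integrable_sum => // k _; under eq_fun do rewrite EFinM.
exact: (integrableZl mD _ (Fi k j)).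
Qed.

Lemma integrable_mulmxr (D : set (measurableTypeR R)) m n p
    (F : R -> 'M[R]_(m, n)) (X : 'M[R]_(n, p)) : measurable D ->
  (forall i j, mu.-integrable D (EFin \o (fun t => F t i j))) ->
  forall i j, mu.-integrable D (EFin \o (fun t => (F t *m X) i j)).
Proof.
move=> mD Fi i j; rewrite /comp; under eq_fun do rewrite mxE -sumEFin.
apply: integrable_sum => // k _; under eq_fun do rewrite mulrC EFinM.
exact: (integrableZl mD _ (Fi i k)).
Qed.

Lemma mulmx_mxint (D : set (measurableTypeR R)) m n p (X : 'M[R]_(p, m)) (F : R -> 'M[R]_(m, n)) :
  measurable D -> (forall i j, mu.-integrable D (EFin \o (fun t => F t i j))) ->
  X *m mxint D F = mxint D (fun t => X *m F t).
Proof.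
move=> mD Fi; apply/matrixP => i j; rewrite !mxE.
under [RHS]eq_Rintegral do rewrite mxE.
rewrite Rintegral_sum//; last first.
  by move=> k; rewrite /comp; under eq_fun do rewrite EFinM; exact: (integrableZl mD _ (Fi k j)).
by apply: eq_bigr => k _; rewrite mxE RintegralZl//; exact: Fi.
Qed.

Lemma trmx_mxint (D : set R) m n (F : R -> 'M[R]_(m, n)) :
  (mxint D F)^T = mxint D (fun t => (F t)^T).
Proof.
apply/matrixP => i j; rewrite !mxE.
by apply: eq_Rintegral => t _; rewrite mxE.
Qed.

Lemma mxint_mulmx (D : set (measurableTypeR R)) m n p (F : R -> 'M[R]_(m, n)) (X : 'M[R]_(n, p)) :
  measurable D -> (forall i j, mu.-integrable D (EFin \o (fun t => F t i j))) ->
  mxint D F *m X = mxint D (fun t => F t *m X).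
Proof.
move=> mD Fi; apply: trmx_inj; rewrite trmx_mul !trmx_mxint mulmx_mxint//.
  by congr mxint; apply/funext => t; rewrite trmx_mul.
move=> i j; apply: eq_integrable (Fi j i) => // t _ /=.
by rewrite mxE.
Qed.

Lemma ge0_Rintegral_eq0 d (T : measurableType d)
    (nu : {measure set T -> \bar R}) (D : set T) (f : T -> R) : measurable D ->
  nu.-integrable D (EFin \o f) -> (forall t, D t -> 0 <= f t) ->
  \int[nu]_(t in D) f t = 0 -> {ae nu, forall t, D t -> f t = 0}.
Proof.
move=> mD fi f0 If0.
have : (\int[nu]_(t in D) `|(EFin \o f) t| = 0)%E.
  rewrite -[RHS]/(0%:E) -If0 fineK ?integrable_fin_num//.
  by apply: eq_integral => t; rewrite inE => Dt /=; rewrite ger0_norm// f0.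
move/ae_eq_integral_abs => /(_ mD (measurable_int _ fi)).
by apply: filterS => t /= ft Dt; have [] := ft Dt.
Qed.

Lemma ae_eq0_Rintegral d (T : measurableType d)
    (nu : {measure set T -> \bar R}) (D : set T) (f : T -> R) : measurable D ->
  measurable_fun D f -> {ae nu, forall t, D t -> f t = 0} ->
  \int[nu]_(t in D) f t = 0.
Proof.
move=> mD mf f0; rewrite /Rintegral (ae_eq_integral (cst 0%E) (EFin \o f))//.
- by rewrite integral0.
- exact/measurable_EFinP.
- by apply: filterS f0 => t /= ft Dt; rewrite ft.
Qed.

Lemma row_mul_tr_eq0 n (x : 'rV[R]_n) : (x *m x^T) ord0 ord0 = 0 -> x = 0.
Proof.
rewrite mxE => x0; apply/rowP => k; rewrite mxE.
have /psumr_eq0P : forall j, true -> 0 <= x ord0 j * x^T j ord0.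
  by move=> j _; rewrite mxE -expr2 sqr_ge0.
move=> /(_ x0 k isT)/eqP; rewrite mxE mulf_eq0 orbb => /eqP <-.
by congr (x _ _); apply/ord_inj.
Qed.

End controllability.

(** * The Gramian and the two implications *)

Section gramian.
Context {R : realType}.
Variables (d N : nat) (al a b : R) (A : 'M[R]_d) (B : 'M[R]_(d, N)) (g : R -> R).
Hypotheses (al_gt0 : 0 < al) (al_lt1 : al < 1) (ab : a < b).
Hypothesis g_cont : {within `[a, b], continuous g}.
Local Notation mu := (@lebesgue_measure R).
Local Notation Q := (fun tau t : R => Phi al A g tau t *m B).
Local Notation w := (fun t : R => (b - t) `^ (1 - al)).

Let al1 : al - 1 != 0.
Proof. by rewrite subr_eq0 lt_eqF. Qed.

Lemma PhiB_spec : exists C, [/\ 0 <= C,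
    forall tau t i j, a <= tau -> tau <= t -> t <= b ->
      `|Q tau t i j| <= C * (t - tau) `^ (al - 1) &
    forall t i j, t <= b ->
      measurable_fun `[a, t] (fun tau => Q tau t i j)].
Proof.
have [C [C0 PC mP]] := Phi_spec d al a b A g al_gt0 al_lt1 g_cont.
have [K K0 BK] := mx_entry_bounded _ _ B.
exists (d%:R * (C * K)); split; first by rewrite !mulr_ge0.
  move=> tau t i j atau taut tb.
  have := mulmx_entry_le _ _ _ (Phi al A g tau t) B _ K _ _ BK i j.
  move=> /(_ (C * (t - tau) `^ (al - 1))); rewrite mulr_ge0 ?powR_ge0//.
  move=> /(_ isT (fun i j => PC _ _ _ _ atau taut tb)) /le_trans; apply.
  by rewrite mulrAC !mulrA.
by move=> t i j tb; apply: measurable_mulmx => // *; exact: mP.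
Qed.

Lemma w_measurable : measurable_fun setT w.
Proof. by apply: (measurableT_comp (measurable_powR _)); exact: measurable_funB. Qed.

(** The weight absorbs one singular factor of [Phi]: in the Gramian integrand one of two is left, in
    the steering control none. *)
Lemma w_mul_le1 t : t <= b -> w t * (b - t) `^ (al - 1) <= 1.
Proof.
move=> tb; have -> : 1 - al = - (al - 1) by rewrite opprB.
by apply: powR_mulN_le1 => //; rewrite subr_ge0.
Qed.

Lemma gramianE : gramian al a b A B g =
  mxint `[a, b] (fun t => w t *: (Q t b *m (Q t b)^T)).
Proof.
by rewrite /gramian; congr mxint; apply/funext => t; rewrite trmx_mul !mulmxA.
Qed.

Lemma gramian_integrable i j : mu.-integrable `[a, b]
  (EFin \o (fun t => (w t *: (Q t b *m (Q t b)^T)) i j)).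
Proof.
have [C [C0 QC mQ]] := PhiB_spec.
apply: (@integrable_le_powR _ al a b (N%:R * (C * C))) => //; first exact: ltW.
  apply: measurable_scalemx; first exact: measurable_funTS w_measurable.
  apply: measurable_mulmx => [k l|]; first exact: mQ.
  by apply: measurable_trmx => k l; exact: mQ.
move=> t; rewrite in_itv/= => /andP[at_ tb].
set p := (b - t) `^ (al - 1); have p0 : 0 <= p by exact: powR_ge0.
have QCt k l : `|Q t b k l| <= C * p by exact: QC.
have QTCt k l : `|(Q t b)^T k l| <= C * p by rewrite mxE.
have h := mulmx_entry_le _ _ _ _ _ _ _ (mulr_ge0 C0 p0) QCt QTCt i j.
rewrite mxE normrM ger0_norm ?powR_ge0//.
apply: le_trans (ler_wpM2l (powR_ge0 _ _) h) _.
have -> : w t * (N%:R * (C * p * (C * p))) = (w t * p) * (N%:R * (C * C) * p) by ring.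
rewrite ler_piMl ?mulr_ge0 ?w_mul_le1//; exact: powR_ge0.
Qed.

Lemma gramian_unit_controllable (y0 : 'cV[R]_d) :
  gramian al a b A B g \in unitmx -> controllable al a b A B g y0.
Proof.
move=> Wu yb; have [C [C0 QC mQ]] := PhiB_spec.
pose z := invmx (gramian al a b A B g) *m (yb - Psi al A g a b *m y0).
have [Z Z0 zZ] := mx_entry_bounded _ _ z.
(* With this choice Q(t, b) u(t) is the Gramian integrand applied to [z], so the control contributes
   W z at time [b]. *)
pose u t := w t *: ((Q t b)^T *m z).
have mu_ k : measurable_fun `[a, b] (fun t => u t k ord0).
  apply: measurable_scalemx; first exact: measurable_funTS w_measurable.
  apply: measurable_mulmx => //.
  by apply: measurable_trmx => i j; exact: mQ.
have u_le t k l : a <= t -> t <= b -> `|u t k l| <= d%:R * (C * Z).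
  move=> at_ tb; set p := (b - t) `^ (al - 1).
  have p0 : 0 <= p by exact: powR_ge0.
  have QTCt i j : `|(Q t b)^T i j| <= C * p by rewrite mxE; exact: QC.
  have h := mulmx_entry_le _ _ _ _ _ _ _ (mulr_ge0 C0 p0) QTCt zZ k l.
  rewrite mxE normrM ger0_norm ?powR_ge0//.
  apply: le_trans (ler_wpM2l (powR_ge0 _ _) h) _.
  have -> : w t * (d%:R * (C * p * Z)) = (w t * p) * (d%:R * (C * Z)) by ring.
  by rewrite ler_piMl ?mulr_ge0 ?w_mul_le1.
exists u; split; first split => // t.
  rewrite in_itv/= => /andP[at_ tb] i.
  (* Admissibility concerns every t up to [b]: the control is bounded, so only the singularity of
     Q(s, t) at s = t remains. *)
  apply: (@integrable_le_powR _ al a t (N%:R * (C * (d%:R * (C * Z))))) => //.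
    apply: measurable_mulmx => [k l|k l]; first exact: mQ.
    rewrite (ord1 l); apply: measurable_funS (mu_ k) => //.
    by apply: subset_itvl; rewrite bnd_simp.
  move=> s; rewrite in_itv/= => /andP[as_ st].
  set p := (t - s) `^ (al - 1); have p0 : 0 <= p by exact: powR_ge0.
  have QCs k l : `|Q s t k l| <= C * p by exact: QC.
  have uZ k l : `|u s k l| <= d%:R * (C * Z) by apply: u_le => //; exact: le_trans tb.
  have := mulmx_entry_le _ _ _ _ _ _ _ (mulr_ge0 C0 p0) QCs uZ i ord0.
  by move/le_trans; apply; rewrite (mulrAC C) !mulrA.
rewrite /solution (_ : mxint _ _ = gramian al a b A B g *m z).
  by rewrite /z mulKVmx// addrC subrK.
rewrite gramianE mxint_mulmx//; last exact: gramian_integrable.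
by congr mxint; apply/funext => t; rewrite /u -scalemxAr -scalemxAl mulmxA.
Qed.

Lemma controllable_gramian_unit (y0 : 'cV[R]_d) :
  controllable al a b A B g y0 -> gramian al a b A B g \in unitmx.
Proof.
move=> ctrl; rewrite -row_free_unit -kermx_eq0.
(* A nonzero [x] with x W = 0 is contradicted by proving x x^T = 0. *)
apply: contraT => /rowV0Pn[x /sub_kermxP xW /negP[]]; apply/eqP/row_mul_tr_eq0.
have [C [C0 QC mQ]] := PhiB_spec.
pose F t := w t *: (Q t b *m (Q t b)^T).
have FE t : x *m F t *m x^T = w t *: ((x *m Q t b) *m (x *m Q t b)^T).
  by rewrite /F -scalemxAr -scalemxAl (trmx_mul x) !mulmxA.
have xFi i j := integrable_mulmxl _ _ _ _ x F (measurable_itv _) gramian_integrable i j.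
have hi := integrable_mulmxr _ _ _ _ _ x^T (measurable_itv _) xFi ord0 ord0.
have h0 t : `[a, b]%classic t -> 0 <= (x *m F t *m x^T) ord0 ord0.
  move=> _; rewrite FE mxE mulr_ge0 ?powR_ge0// mxE sumr_ge0// => k _.
  by rewrite [X in _ * X]mxE -expr2 sqr_ge0.
have Ih : \int[mu]_(t in `[a, b]) (x *m F t *m x^T) ord0 ord0 = 0.
  transitivity ((x *m gramian al a b A B g *m x^T) ord0 ord0).
    rewrite gramianE mulmx_mxint//; last exact: gramian_integrable.
    by rewrite mxint_mulmx// mxE.
  by rewrite xW mul0mx mxE.
have h_ae : {ae mu, forall t, `[a, b]%classic t -> (x *m F t *m x^T) ord0 ord0 = 0}.
  have mab : measurable (`[a, b]%classic : set (measurableTypeR R)) by [].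
  exact: (ge0_Rintegral_eq0 _ _ mu _ _ mab hi h0 Ih).
have xQ_ae : {ae mu, forall t, `[a, b]%classic t -> x *m Q t b = 0}.
  apply: (@filterS _ _ (ae_filter_ringOfSetsType mu) _ _ _ h_ae) => t /= ht tab; have := ht tab.
  move: tab; rewrite in_itv/= => /andP[at_]; rewrite le_eqVlt => /predU1P[->|tb] H.
    (* At t = b the weight vanishes and yields no information, but there the bound on [Q] is [C]
       times 0 raised to al - 1, which is 0. *)
    apply/rowP => k; rewrite mxE big1 ?mxE// => l _.
    have := QC b b l k (ltW ab) (lexx b) (lexx b).
    by rewrite subrr powR0// mulr0 normr_le0 => /eqP ->; rewrite mulr0.
  apply: row_mul_tr_eq0; move/eqP: H; rewrite FE mxE mulf_eq0 => /orP[|/eqP//].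
  by rewrite powR_eq0 subr_eq0 gt_eqF.
(* The target differs from the uncontrolled final state by x^T, so x x^T is the integral of x Q(t,
   b) u(t), whose integrand is 0 almost everywhere. *)
have [u [[_ ui] uy]] := ctrl (Psi al A g a b *m y0 + x^T).
have {}ui : forall i j, mu.-integrable `[a, b]
    (EFin \o (fun t => (Q t b *m u t) i j)).
  by move=> i j; rewrite (ord1 j); apply: ui; rewrite in_itv/= lexx ltW.
move/addrI: uy => <-; rewrite mulmx_mxint// mxE.
apply: ae_eq0_Rintegral => //.
  have := integrable_mulmxl _ _ _ _ x _ (measurable_itv _) ui ord0 ord0.
  by move/measurable_int/measurable_EFinP.
apply: (@filterS _ _ (ae_filter_ringOfSetsType mu) _ _ _ xQ_ae) => t /= xQ tab.
by rewrite mulmxA xQ// mul0mx mxE.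
Qed.

End gramian.

Theorem theorem3p3 (R : realType) (d N : nat) (al a b : R)
    (A : 'M[R]_d) (B : 'M[R]_(d, N)) (g : R -> R) (y0 : 'cV[R]_d)
    (al_gt0 : 0 < al) (al_lt1 : al < 1) (ab : a < b)
    (A_sym : A^T = A)
    (g_cont : {within `[a, b], continuous g})
    (g_neq0 : {ae lebesgue_measure, forall t, t \in `[a, b] -> g t != 0}) :
  controllable al a b A B g y0 <-> gramian al a b A B g \in unitmx.
Proof.
split; first exact: controllable_gramian_unit.
exact: gramian_unit_controllable.
Qed.
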